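(* Let $R=R_1\times\cdots\times R_s$ be a finite commutative ring with identity $1\neq0$, where each $R_i$ is a finite local ring with maximal ideal $M_i$ of order $m_i$, $|R_1|/m_1\le\cdots\le|R_s|/m_s$, and $|R_i|/m_i\equiv 1\pmod 4$ for $1\le i\le s$. Let $R_0$ be a finite local ring with maximal ideal $M_0$ of order $m_0$ such that $|R_0|/m_0\equiv 3\pmod 4$. For disjoint subsets $A,B\subseteq\{1,\dots,s\}$ put $$\lambda_{A,B}=(-1)^{|B|}\frac{|R^\times|}{2^s\prod_{i\in A}\left(\sqrt{|R_i|/m_i}+1\right)\prod_{j\in B}\left(\sqrt{|R_j|/m_j}-1\right)}.$$ Then the eigenvalues of $\mathcal{G}_{R_0\times R}$ (with multiplicity) are: (a) for every pair $(A,B)$ of disjoint subsets of $\{1,\dots,s\}$, the value $|R_0^\times|\cdot\lambda_{A,B}$, repeated $\frac{1}{2^{|A|+|B|}}\prod_{k\in A\cup B}(|R_k|/m_k-1)$ times; (b) for every such pair, the value $-\frac{|R_0^\times|}{|R_0|/m_0-1}\cdot\lambda_{A,B}$, repeated $\frac{|R_0|/m_0-1}{2^{|A|+|B|}}\prod_{k\in A\cup B}(|R_k|/m_k-1)$ times; and (c) $0$ with multiplicity $|R_0||R|-\sum_{A,B\subseteq\{1,\dots,s\},\,A\cap B=\emptyset}\frac{|R_0|/m_0}{2^{|A|+|B|}}\prod_{k\in A\cup B}(|R_k|/m_k-1)$.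
   Context: A local ring is a commutative ring with a unique maximal ideal. For a finite commutative ring $S$, $S^\times$ is its unit group, $Q_S=\{u^2:u\in S^\times\}$, $T_S=Q_S\cup(-Q_S)$, and the quadratic unitary Cayley graph $\mathcal{G}_S$ has vertex set $S$ with $x,y$ adjacent iff $x-y\in T_S$. Eigenvalues of a graph are those of its adjacency matrix. Empty products equal $1$. *)

(* Defs.v *)
From HB Require Import structures.
From mathcomp Require Import all_boot all_order all_algebra.

Set Implicit Arguments.
Unset Strict Implicit.
Unset Printing Implicit Defensive.

Import GRing.Theory.
Local Open Scope ring_scope.

(* The direct product R_0 x ... x R_n of n.+1 rings, with componentwise
   operations. The index type 'I_n.+1 is nonempty, so that 1 != 0. *)
Definition prod_ring (n : nat) (R : 'I_n.+1 -> finComUnitRingType) : Type :=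
  {dffun forall i, R i}.

Section ProdRing.
Variables (n : nat) (R : 'I_n.+1 -> finComUnitRingType).
Local Notation P := (prod_ring R).
Implicit Types x y z : P.

HB.instance Definition _ := Finite.on P.

Definition prod_zero : P := [ffun i => 0 : R i].
Definition prod_opp x : P := [ffun i => - x i].
Definition prod_add x y : P := [ffun i => x i + y i].
Definition prod_one : P := [ffun i => 1 : R i].
Definition prod_mul x y : P := [ffun i => x i * y i].
Definition prod_unit : pred P := fun x => [forall i, x i \is a GRing.unit].
Definition prod_inv x : P :=
  if prod_unit x then [ffun i => (x i)^-1] else x.

Fact prod_addA : associative prod_add.
Proof. by move=> x y z; apply/ffunP=> i; rewrite !ffunE addrA. Qed.
Fact prod_addC : commutative prod_add.
Proof. by move=> x y; apply/ffunP=> i; rewrite !ffunE addrC. Qed.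
Fact prod_add0 : left_id prod_zero prod_add.
Proof. by move=> x; apply/ffunP=> i; rewrite !ffunE add0r. Qed.
Fact prod_addN : left_inverse prod_zero prod_opp prod_add.
Proof. by move=> x; apply/ffunP=> i; rewrite !ffunE addNr. Qed.

HB.instance Definition _ :=
  GRing.isZmodule.Build P prod_addA prod_addC prod_add0 prod_addN.

Fact prod_mulA : associative prod_mul.
Proof. by move=> x y z; apply/ffunP=> i; rewrite !ffunE mulrA. Qed.
Fact prod_mulC : commutative prod_mul.
Proof. by move=> x y; apply/ffunP=> i; rewrite !ffunE mulrC. Qed.
Fact prod_mul1 : left_id prod_one prod_mul.
Proof. by move=> x; apply/ffunP=> i; rewrite !ffunE mul1r. Qed.
Fact prod_mulD : left_distributive prod_mul prod_add.
Proof. by move=> x y z; apply/ffunP=> i; rewrite !ffunE mulrDl. Qed.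
Fact prod_oner_neq0 : prod_one != prod_zero.
Proof. by apply/eqP=> /ffunP/(_ ord0)/eqP; rewrite !ffunE oner_eq0. Qed.

HB.instance Definition _ := GRing.Zmodule_isComNzRing.Build P
  prod_mulA prod_mulC prod_mul1 prod_mulD prod_oner_neq0.

Fact prod_mulVr : {in prod_unit, left_inverse 1 prod_inv *%R}.
Proof.
move=> x Ux; rewrite /prod_inv -topredE /= in Ux *; rewrite Ux.
by apply/ffunP=> i; rewrite !ffunE mulVr ?(forallP Ux).
Qed.
Fact prod_unitPl x y : y * x = 1 -> prod_unit x.
Proof.
move=> yx1; apply/forallP=> i; apply/unitrP; exists (y i).
by move/ffunP/(_ i): yx1; rewrite !ffunE => yx1; rewrite [x i * _]mulrC.
Qed.
Fact prod_inv_out : {in [predC prod_unit], prod_inv =1 id}.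
Proof. by move=> x; rewrite inE /= /prod_inv -topredE /= => /negPf->. Qed.

HB.instance Definition _ := GRing.ComNzRing_hasMulInverse.Build P
  prod_mulVr prod_unitPl prod_inv_out.

End ProdRing.

(* The library equips the binary product with its finite and its ring structure,
   but not with their join. *)
HB.instance Definition _ (R1 R2 : finComUnitRingType) :=
  GRing.ComUnitRing.on (R1 * R2)%type.

(* idealr_closed J says that J is a proper ideal. *)
Definition maximal_ideal (S : finComUnitRingType) (M : {set S}) : Prop :=
  idealr_closed M /\
  forall J : {set S}, idealr_closed J -> M \subset J -> J = M.

Definition local_ring (S : finComUnitRingType) (M : {set S}) : Prop :=
  maximal_ideal M /\ forall J : {set S}, maximal_ideal J -> J = M.

Definition unit_set (S : finComUnitRingType) : {set S} :=
  [set u | u \is a GRing.unit].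

Definition unit_squares (S : finComUnitRingType) : {set S} :=
  [set u ^+ 2 | u in unit_set S].

Definition qu_connection (S : finComUnitRingType) : {set S} :=
  unit_squares S :|: [set - x | x in unit_squares S].

Definition qu_cayley (S : finComUnitRingType) : rel S :=
  fun x y => x - y \in qu_connection S.

Definition adjacency_mx (F : nzRingType) (V : finType) (e : rel V) :
    'M[F]_#|V| :=
  \matrix_(i, j) (e (enum_val i) (enum_val j))%:R.

(* The eigenvalues of the graph e, counted with multiplicity, are obtained by
   repeating p.1 exactly p.2 times for each p in l. The values p.1 need not be
   distinct: the multiplicities of equal values add up. *)
Definition has_spectrum (F : fieldType) (V : finType) (e : rel V)
    (l : seq (F * nat)) : Prop :=
  char_poly (adjacency_mx F e) = \prod_(p <- l) ('X - p.1%:P) ^+ p.2.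

(* |S| / m, the order of the residue field S / M (the division is exact). *)
Definition residue_card (S : finComUnitRingType) (M : {set S}) : nat :=
  (#|S| %/ #|M|)%N.

Section Eigenvalues.
Variables (F : rcfType) (n : nat).
Variables (R : 'I_n.+1 -> finComUnitRingType) (M : forall i, {set R i}).
Implicit Types A B : {set 'I_n.+1}.

Definition lambda A B : F :=
  (-1) ^+ #|B| * (#|unit_set (prod_ring R)|%:R /
    (2 ^+ n.+1
     * \prod_(i in A) (Num.sqrt (residue_card (M i))%:R + 1)
     * \prod_(j in B) (Num.sqrt (residue_card (M j))%:R - 1))).

(* c / 2 ^ (|A| + |B|) * \prod_(k in A u B) (|R_k| / m_k - 1). The division is
   exact when A and B are disjoint and all |R_k| / m_k are odd. *)
Definition repetitions (c : nat) A B : nat :=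
  ((c * \prod_(k in A :|: B) (residue_card (M k) - 1))
     %/ 2 ^ (#|A| + #|B|))%N.

End Eigenvalues.

Definition disjoint_pairs (I : finType) : {set {set I} * {set I}} :=
  [set AB : {set I} * {set I} | [disjoint AB.1 & AB.2]].

(* Main.v *)
Require Import Defs.
From mathcomp Require Import all_boot all_order all_algebra all_fingroup.
From mathcomp Require Import zify ring lra.

Set Implicit Arguments.
Unset Strict Implicit.
Unset Printing Implicit Defensive.

Import Order.TTheory GRing.Theory Num.Theory.
Local Open Scope ring_scope.

(* Since -1 is a square in each R_i and a nonsquare in R_0, the connection set
   is the product of all units of R_0 with the unit squares of the R_i. Hence
   the adjacency matrix is a tensor product of convolution operators. In a
   local ring S with maximal ideal M, |S/M| = q and |M| = m, the functions 1,
   [x in M] and the quadratic character chi are closed under convolution, with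
   chi * chi = chi(-1) m (q [x in M] - 1). Therefore the indicators of the units
   and of the unit squares are explicit combinations of orthogonal idempotents,
   the trace of an idempotent being the multiplicity of its coefficient as an
   eigenvalue. Tensor products of these idempotents are again orthogonal
   idempotents, and those of the R_i are indexed by the disjoint pairs (A, B). *)

(** * Spectra from orthogonal idempotents *)

(* With [E = C *m B] and [B *m C = 1], evaluate the determinant of
   [block_mx 'X (c C) B 1] by eliminating [B] in the two possible ways. *)
Lemma char_poly_idempotent (F : fieldType) (N : nat) (c : F) (E : 'M[F]_N) :
  E *m E = E ->
  char_poly (c *: E) * 'X ^+ \rank E = 'X ^+ N * ('X - c%:P) ^+ \rank E.
Proof.
move=> EE; set r := \rank E.
set C := col_base E; set B := row_base E.
have CB : C *m B = E by rewrite mulmx_base.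
have BC : B *m C = 1%:M.
  apply: (row_full_inj (col_base_full E)).
  apply: (row_free_inj (row_base_free E)).
  by rewrite -/C -/B mulmx1 mulmxA CB -mulmxA CB.
pose Cp := map_mx polyC C; pose Bp := map_mx polyC B.
have BCp : Bp *m Cp = 1%:M by rewrite -map_mxM BC map_mx1.
pose T := block_mx ('X%:M : 'M_N) (c%:P *: Cp) Bp (1%:M : 'M_r).
have detT : \det T = char_poly (c *: E).
  have <- : \det T * \det (block_mx (1%:M : 'M_N) 0 (- Bp) (1%:M : 'M_r))
      = \det T.
    by rewrite det_lblock !det1 !mulr1.
  rewrite -det_mulmx mulmx_block !mulmx1 !mulmx0 !add0r mul1mx subrr.
  rewrite det_ublock det1 mulr1 /char_poly /char_poly_mx; congr (\det _).
  by rewrite mulmxN -scalemxAl -map_mxM CB map_mxZ.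
have := erefl (\det (block_mx 1%:M 0 (- Bp) ('X%:M : 'M_r) *m T)).
rewrite {1}det_mulmx det_lblock det1 mul1r det_scalar detT mulrC => ->.
rewrite mulmx_block !mul1mx !mul0mx !addr0 mulmx1 mul_mx_scalar mul_scalar_mx.
rewrite scalerN addNr det_ublock det_scalar; congr (_ * _).
rewrite -scalemxAr mulNmx BCp scalerN scalemx1 addrC -raddfB det_scalar //.
Qed.

(** In a rank factorization [E = C *m B] of an idempotent, [B *m C] is the identity of size
    [\rank E], and the trace is cyclic. *)
Lemma mxtrace_idempotent (F : fieldType) (N : nat) (E : 'M[F]_N) :
  E *m E = E -> \tr E = (\rank E)%:R.
Proof.
move=> EE.
have BC : row_base E *m col_base E = 1%:M.
  apply: (row_full_inj (col_base_full E)).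
  apply: (row_free_inj (row_base_free E)).
  by rewrite mulmx1 mulmxA mulmx_base -mulmxA mulmx_base.
by rewrite -{1}(mulmx_base E) mxtrace_mulC BC mxtrace1.
Qed.

(* [('X - A) ('X - B) = 'X ('X - (A + B))]. *)
Lemma char_poly_add_orthogonal (F : fieldType) (N : nat) (A B : 'M[F]_N) :
  A *m B = 0 -> char_poly A * char_poly B = 'X ^+ N * char_poly (A + B).
Proof.
move=> AB; rewrite -det_mulmx -det_scalar -det_mulmx; congr (\det _).
rewrite /char_poly_mx mulmxBl !mulmxBr -map_mxM AB map_mx0 subr0.
by rewrite map_mxD !mul_scalar_mx mul_mx_scalar scalerDr opprD addrA addrAC.
Qed.

(** Induction on [r], splitting off one idempotent at a time. Characteristic 0 lets the traces [t]
    determine the ranks. *)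
Lemma char_poly_orthogonal_idempotents (F : numFieldType) (N : nat)
    (J : eqType) (r : seq J) (E : J -> 'M[F]_N) (c : J -> F) (t : J -> nat) :
  uniq r ->
  {in r &, forall i j, E i *m E j = if i == j then E i else 0} ->
  {in r, forall j, \tr (E j) = (t j)%:R} ->
  char_poly (\sum_(j <- r) c j *: E j) =
    \prod_(j <- r) ('X - (c j)%:P) ^+ t j * 'X ^+ (N - \sum_(j <- r) t j).
Proof.
move=> Ur EE trE.
have rankE j : j \in r -> \rank (E j) = t j.
  move=> jr; apply/eqP; rewrite -(eqr_nat F) -trE //.
  by rewrite mxtrace_idempotent // EE // eqxx.
have X0 k : 'X ^+ k != 0 :> {poly F} by rewrite expf_neq0 ?polyX_eq0.
have sum_le : (\sum_(j <- r) t j <= N)%N.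
  (* A sum of orthogonal idempotents is idempotent; its rank is the sum of the traces, which bounds
     that sum by [N]. *)
  have idem : (\sum_(j <- r) E j) *m (\sum_(j <- r) E j) = \sum_(j <- r) E j.
    rewrite mulmx_suml; apply: eq_big_seq => i ir.
    rewrite mulmx_sumr (bigD1_seq i) //= EE // eqxx big_seq_cond big1 ?addr0 //.
    by move=> j /andP[jr ij]; rewrite EE // eq_sym (negPf ij).
  rewrite -(ler_nat F) natr_sum (eq_big_seq (fun j => \tr (E j))); last first.
    by move=> j jr; rewrite trE.
  by rewrite -linear_sum /= mxtrace_idempotent // ler_nat rank_leq_row.
(* Multiplying by this power of ['X] turns the truncated exponent into [N], so that the induction
   involves no subtraction. *)
apply: (mulIf (X0 (\sum_(j <- r) t j)%N)); rewrite -mulrA -exprD subnK //.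
rewrite mulrC [RHS]mulrC {sum_le trE}; elim: r Ur EE rankE => [|i r IH] /=.
  by rewrite !big_nil mul1r mulr1 /char_poly /char_poly_mx map_mx0
       subr0 det_scalar.
case/andP=> inr Ur EE rankE; rewrite !big_cons.
(* The extra factor ['X ^+ N] is the one that appears in [char_poly_add_orthogonal]. *)
apply: (mulfI (X0 N)); rewrite exprD.
have -> : 'X^N * ('X^(t i) * 'X^(\sum_(j <- r) t j) *
     char_poly (c i *: E i + \sum_(j <- r) c j *: E j)) =
  'X^(t i) * 'X^(\sum_(j <- r) t j) *
   ('X^N * char_poly (c i *: E i + \sum_(j <- r) c j *: E j)) by ring.
rewrite -char_poly_add_orthogonal; last first.
  rewrite mulmx_sumr big_seq big1 // => j jr.
  rewrite -scalemxAl -scalemxAr EE ?inE ?eqxx ?jr ?orbT //.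
  by case: eqP => [ij | _]; [rewrite ij jr in inr | rewrite !scaler0].
have -> : 'X^(t i) * 'X^(\sum_(j <- r) t j) *
   (char_poly (c i *: E i) * char_poly (\sum_(j <- r) c j *: E j)) =
  (char_poly (c i *: E i) * 'X^(t i)) *
  ('X^(\sum_(j <- r) t j) * char_poly (\sum_(j <- r) c j *: E j)) by ring.
rewrite IH //; first last.
- by move=> j jr; apply: rankE; rewrite inE jr orbT.
- by move=> j k jr kr; apply: EE; rewrite inE ?jr ?kr orbT.
have ri : i \in i :: r by rewrite inE eqxx.
by rewrite -(rankE i) // char_poly_idempotent ?EE ?eqxx //; ring.
Qed.

(** * Convolution operators on a finite abelian group *)

Section Convolution.
Variables (F : numFieldType) (V : finZmodType).
Implicit Types f g h : V -> F.

Definition conv f g : V -> F := fun z => \sum_y f (z - y) * g y.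

Definition conv_mx f : 'M[F]_#|V| :=
  \matrix_(i, j) f (enum_val i - enum_val j).

Lemma conv_mxM f g : conv_mx f *m conv_mx g = conv_mx (conv f g).
Proof.
apply/matrixP=> i j; rewrite !mxE /conv.
transitivity (\sum_(z in V) f (enum_val i - z) * g (z - enum_val j)).
  by rewrite [RHS]big_enum_val; apply: eq_bigr => k _; rewrite !mxE.
rewrite (reindex_inj (addIr (enum_val j))); apply: eq_bigr => y _.
by rewrite addrK opprD addrA addrAC.
Qed.

Lemma conv_mx_trace f : \tr (conv_mx f) = #|V|%:R * f 0.
Proof.
rewrite /mxtrace (eq_bigr (fun => f 0)) => [|i _]; last by rewrite mxE subrr.
by rewrite sumr_const card_ord mulr_natl.
Qed.

(** The adjacency matrix is [conv_mx] of the indicator of [T], and the trace of [conv_mx (e j)] is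
    [#|V|%:R * e j 0]. The dimensions not covered by the idempotents lie in the kernel. *)
Lemma conv_spectrum (T : {set V}) (J : eqType) (r : seq J) (e : J -> V -> F)
    (c : J -> F) (t : J -> nat) :
  uniq r ->
  {in r &, forall i j, conv (e i) (e j) =1 if i == j then e i else fun=> 0} ->
  {in r, forall j, #|V|%:R * e j 0 = (t j)%:R} ->
  (forall z, (z \in T)%:R = \sum_(j <- r) c j * e j z) ->
  @has_spectrum F V (fun x y => x - y \in T)
    ([seq (c j, t j) | j <- r] ++ [:: (0, (#|V| - \sum_(j <- r) t j)%N)]).
Proof.
move=> Ur ee tr_e Tsum; rewrite /has_spectrum big_cat big_map big_seq1 /= subr0.
rewrite -(@char_poly_orthogonal_idempotents _ _ _ _ (fun j => conv_mx (e j))) //.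
- congr char_poly; apply/matrixP=> i j; rewrite mxE Tsum summxE.
  by apply: eq_bigr => k _; rewrite !mxE.
- move=> i j ir jr; rewrite conv_mxM; apply/matrixP=> x y.
  by rewrite mxE ee //; case: eqP => _; rewrite mxE.
- by move=> j jr; rewrite conv_mx_trace tr_e.
Qed.

End Convolution.

(** * Unit squares of a local ring *)

(** Removing a two-element orbit [[set x; f x]] keeps the parity, until only fixed points remain. *)
Lemma odd_card_involution (T : finType) (f : T -> T) (A : {set T}) :
  involutive f -> {in A, forall x, f x \in A} ->
  odd #|A| = odd #|[set x in A | f x == x]|.
Proof.
move=> fK; have [k] := ubnP #|A|; elim: k A => // k IH A leA fA.
have [A_fix | [x]] := set_0Vmem (A :\: [set x in A | f x == x]).
  congr (odd #|pred_of_set _|); apply/setP=> x; rewrite inE.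
  by move/setP/(_ x): A_fix; rewrite !inE;
    case: (x \in A) => //=; rewrite andbT => /negbFE ->.
rewrite !inE => /andP[+ xA]; rewrite xA /= => fx.
set B := A :\: [set x; f x].
have cardA : #|A| = #|B|.+2.
  rewrite -(cardsID [set x; f x] A) (setIidPr _) ?cards2 1?eq_sym ?fx //.
  by rewrite subUset !sub1set xA fA.
rewrite cardA /= negbK IH; first last.
- move=> y; rewrite !inE !negb_or => /andP[/andP[yx yfx] yA].
  by rewrite fA // (inv_eq fK) yfx (inj_eq (inv_inj fK)) yx.
- by rewrite cardA in leA; rewrite -ltnS (ltn_trans _ leA).
congr (odd #|pred_of_set _|); apply/setP=> y; rewrite !inE.
case: (eqVneq y x) => [->|_] /=; first by rewrite (negPf fx) andbF.
case: (eqVneq y (f x)) => [->|//] /=.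
by rewrite fK eq_sym (negPf fx) andbF.
Qed.

(** * Ideals and units of a finite local ring *)

Section Ideals.
Variables (S : finComUnitRingType).
Implicit Types J M : {set S}.

Lemma idealr_closedD J : idealr_closed J -> {in J &, forall x y, x + y \in J}.
Proof. by case=> _ _ JD x y xJ yJ; rewrite -[x]mul1r JD. Qed.

Lemma idealr_closedMl J a : idealr_closed J -> {in J, forall x, a * x \in J}.
Proof. by case=> J0 _ JD x xJ; rewrite -[_ * _]addr0 JD. Qed.

Lemma idealr_closedN J x : idealr_closed J -> (- x \in J) = (x \in J).
Proof.
suff NJ y : idealr_closed J -> y \in J -> - y \in J.
  by move=> idJ; apply/idP/idP=> /(NJ _ idJ); rewrite ?opprK.
by move=> idJ yJ; rewrite -mulN1r idealr_closedMl.
Qed.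

Lemma idealr_closedDr J x y : idealr_closed J -> y \in J ->
  (x + y \in J) = (x \in J).
Proof.
move=> idJ yJ; apply/idP/idP=> xJ; last exact: idealr_closedD.
by rewrite -[x](addrK y) idealr_closedD ?idealr_closedN.
Qed.

(** A nonunit generates a proper principal ideal; by finiteness this lies in a maximal ideal, which
    must be [M]. *)
Lemma local_ring_unit M x : local_ring M -> (x \is a GRing.unit) = (x \notin M).
Proof.
case=> -[idM maxM] uniqM; apply/idP/idP => [Ux | ].
  apply/negP=> xM; have [_ /negP[]] := idM.
  by rewrite -(mulVr Ux) (idealr_closedMl _ idM).
apply: contraR => nUx.
(* A boolean form of [idealr_closed], as [maxset_exists] requires. *)
pose idealb J := [&& 0 \in J, 1 \notin J
  & [forall a, forall u in J, forall v in J, a * u + v \in J]].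
have idealP J : reflect (idealr_closed J) (idealb J).
  apply: (iffP and3P) => -[J0 J1 JD]; split=> //.
    by move=> a u v uJ vJ; move/forallP/(_ a)/forall_inP/(_ u uJ)/forall_inP: JD; apply.
  by apply/forallP=> a; apply/forall_inP=> u uJ; apply/forall_inP=> v vJ; apply: JD.
have : idealb [set y * x | y in S].
  apply/idealP; split.
  - by apply/imsetP; exists 0; rewrite ?mul0r.
  - apply: contra nUx => /imsetP[y _ yx1]; apply/unitrP; exists y.
    by rewrite [x * y]mulrC -yx1.
  - move=> a _ _ /imsetP[u _ ->] /imsetP[v _ ->].
    by apply/imsetP; exists (a * u + v); rewrite // mulrDl mulrA.
case/maxset_exists=> J /maxsetP[/idealP idJ maxJ] sJ.
rewrite -(uniqM J); first by apply: (subsetP sJ); apply/imsetP; exists 1; rewrite ?mul1r.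
by split=> // K idK JK; apply: maxJ => //; apply/idealP.
Qed.

Lemma card_local_ring M : local_ring M -> #|S| = (residue_card M * #|M|)%N.
Proof.
case=> -[idM _] _; have gM : group_set M.
  by apply/group_setP; split; [case: idM | move=> x y; exact: idealr_closedD].
by rewrite /residue_card divnK // -[#|S|]cardsT (cardSg (subsetT (Group gM))).
Qed.

(* Otherwise [M] has index 2 in the additive group [M U (1 + M)]. *)
Lemma two_unit M : local_ring M -> odd (residue_card M) ->
  (2 : S) \is a GRing.unit.
Proof.
move=> localM; rewrite (local_ring_unit _ localM).
have [[idM maxM] _] := localM; apply: contraL => M2.
have [M0 M1 _] := idM.
have M_add1 x : x \in M -> 1 + x \notin M by move=> xM; rewrite idealr_closedDr.
pose H := [set x | (x \in M) || (x - 1 \in M)].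
have gH : group_set H.
  apply/group_setP; split; first by rewrite inE M0.
  move=> /= x y; rewrite !inE FinRing.zmodMgE.
  case/orP=> xM /orP[]yM.
  - by apply/orP; left; apply: idealr_closedD.
  - by apply/orP; right; rewrite -addrA; apply: idealr_closedD.
  - by apply/orP; right; rewrite addrAC; apply: idealr_closedD.
  - apply/orP; left; have -> : x + y = (x - 1) + (y - 1) + 2 by ring.
    by apply: idealr_closedD => //; apply: idealr_closedD.
have cardH : #|H| = (2 * #|M|)%N.
  pose M' := [set x + 1 | x in M].
  have -> : H = M :|: M'.
    apply/setP=> x; rewrite !inE; congr (_ || _).
    apply/idP/imsetP => [xM | [y yM ->]]; last by rewrite addrK.
    by exists (x - 1); rewrite // subrK.
  have -> : #|M :|: M'| = (#|M| + #|M'|)%N.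
    apply/eqP; have [_ ->] := leq_card_setU M M'.
    rewrite disjoint_subset; apply/subsetP=> x xM.
    rewrite inE; apply/imsetP=> -[y yM xy].
    by have := M_add1 _ yM; rewrite addrC -xy xM.
  by rewrite card_imset ?mul2n ?addnn //; apply: addIr.
have := cardSg (subsetT (Group gH)).
rewrite /= cardH cardsT (card_local_ring localM) dvdn_pmul2r ?dvdn2 //.
by apply/card_gt0P; exists 0.
Qed.

End Ideals.

(** * Squares when the residue field has odd order *)

Section OddLocalRing.
Variables (S : finComUnitRingType) (M : {set S}).
Hypotheses (localM : local_ring M) (odd_q : odd (residue_card M)).
Local Notation U := (unit_set S).
Local Notation Q := (unit_squares S).
Local Notation q := (residue_card M).
Implicit Types x y u v : S.

Let idM : idealr_closed M. Proof. by case: localM => [[]]. Qed.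
Let unit2 : (2 : S) \is a GRing.unit. Proof. exact: two_unit odd_q. Qed.
Let unitE x : (x \is a GRing.unit) = (x \notin M).
Proof. exact: local_ring_unit. Qed.

Lemma neg_neq x : x \is a GRing.unit -> - x != x.
Proof.
move=> Ux; apply: contraL Ux => /eqP xx.
have /eqP : 2 * x = 0 by rewrite mulr_natl mulr2n -{1}xx addNr.
by rewrite -(mulr0 2) (inj_eq (mulrI unit2)) => /eqP->; rewrite unitr0.
Qed.

(** Since 2 is a unit, negation fixes only 0 in [M]. *)
Lemma odd_card_maximal_ideal : odd #|M|.
Proof.
rewrite (@odd_card_involution _ -%R); first last.
- by move=> x; rewrite idealr_closedN.
- exact: opprK.
suff -> : [set x in M | - x == x] = [set 0] by rewrite cards1.
apply/setP=> x; rewrite !inE; case: eqP => [xx | ]; last first.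
  by rewrite andbF; case: eqP => // ->; rewrite oppr0.
have : 2 * x = 2 * 0 by rewrite mulr0 mulr_natl mulr2n -{1}xx addNr.
by move/(mulrI unit2)->; rewrite eqxx; case: idM => ->.
Qed.

Lemma card_unit_set : #|U| = ((q - 1) * #|M|)%N.
Proof.
have -> : U = ~: M by apply/setP=> x; rewrite !inE unitE.
by rewrite cardsCs setCK (card_local_ring localM) // mulnBl mul1n.
Qed.

(* [2 u] is a unit, hence so is [u - v] or [u + v]. *)
Lemma unit_sqr_eq u v : u \is a GRing.unit ->
  (u ^+ 2 == v ^+ 2) = (u == v) || (u == - v).
Proof.
move=> Uu; apply/idP/idP=> [|/orP[]/eqP->]; rewrite ?sqrrN //.
rewrite -subr_eq0 subr_sqr => /eqP uv0.
have : (u - v \is a GRing.unit) || (u + v \is a GRing.unit).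
  rewrite !unitE -negb_and; apply: contraL Uu => /andP[] uv1 uv2.
  rewrite unitE negbK; have := idealr_closedMl 2^-1 idM (idealr_closedD idM uv1 uv2).
  by rewrite addrACA addNr addr0 -mulr2n -[u *+ 2]mulr_natl mulKr.
case/orP=> Uuv; apply/orP.
  right; rewrite -addr_eq0; apply/eqP/(mulrI Uuv); by rewrite uv0 mulr0.
by left; rewrite -subr_eq0; apply/eqP/(mulIr Uuv); rewrite uv0 mul0r.
Qed.

Lemma unit_squaresP x :
  reflect (exists2 u, u \is a GRing.unit & x = u ^+ 2) (x \in Q).
Proof.
apply: (iffP imsetP) => -[u]; first by rewrite inE; exists u.
by move=> Uu ->; exists u; rewrite ?inE.
Qed.

Lemma unit_squares_unit x : x \in Q -> x \is a GRing.unit.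
Proof. by case/unit_squaresP=> u Uu ->; rewrite unitrX. Qed.

(** Each fibre of squaring on the units is a pair [[set v; - v]]. *)
Lemma card_unit_squares : #|U| = (2 * #|Q|)%N.
Proof.
rewrite -sum1_card (partition_big_imset (fun u => u ^+ 2)) /=.
rewrite mulnC -sum_nat_const; apply: eq_bigr => _ /unit_squaresP[v Uv ->].
rewrite sum1dep_card; transitivity #|[set v; - v]|; last first.
  by rewrite cards2 eq_sym neg_neq.
apply: eq_card => u; rewrite !inE [_ ^+ _ == _]eq_sym unit_sqr_eq //.
rewrite [v == u]eq_sym -eqr_oppLR [- v == u]eq_sym andb_idl //.
by case/orP=> /eqP->; rewrite ?unitrN.
Qed.

Lemma unit_squaresM x y : x \in Q -> y \in Q -> x * y \in Q.
Proof.
case/unit_squaresP=> u Uu -> /unit_squaresP[v Uv ->].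
by apply/unit_squaresP; exists (u * v); rewrite ?unitrM ?Uu // exprMn.
Qed.

Lemma unit_squaresV x : x \in Q -> x^-1 \in Q.
Proof.
case/unit_squaresP=> u Uu ->.
by apply/unit_squaresP; exists u^-1; rewrite ?unitrV // exprVn.
Qed.

(* Squaring is injective on [1 + M], since [u = - v] would put 2 in [M]. *)
Lemma unit_squares1D x : x \in M -> 1 + x \in Q.
Proof.
move=> xM; pose D := [set 1 + y | y in M].
have DP y : (y \in D) = (y - 1 \in M).
  apply/imsetP/idP=> [[z zM ->]|yM]; first by rewrite addrC addKr.
  by exists (y - 1); rewrite // addrC subrK.
have UD y : y \in D -> y \is a GRing.unit.
  rewrite DP unitE => yM; rewrite -[y](subrK 1) addrC idealr_closedDr //.
  by case: idM.
have sqD y : y \in D -> y ^+ 2 \in D.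
  by rewrite !DP subr_sqr_1 mulrC; apply: idealr_closedMl.
have inj : {in D &, injective (fun y : S => y ^+ 2)}.
  move=> u v uD vD /eqP; rewrite unit_sqr_eq ?UD // => /orP[/eqP //|/eqP uv].
  move: uD vD; rewrite !DP uv => /(idealr_closedD idM) /[apply].
  rewrite addrACA addNr add0r -opprD idealr_closedN // => M2.
  by have := unit2; rewrite unitE M2.
have : [set y ^+ 2 | y in D] = D.
  apply/eqP; rewrite eqEcard (card_in_imset inj) leqnn andbT.
  by apply/subsetP=> _ /imsetP[y yD ->]; apply: sqD.
have xD : 1 + x \in D by rewrite DP addrC addKr.
move/setP/(_ (1 + x)); rewrite xD => /imsetP[u uD ->].
by apply/unit_squaresP; exists u; rewrite ?UD.
Qed.

(** Being a unit square depends only on the class modulo [M], because [1 + M] consists of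
    squares. *)
Lemma unit_squaresDr x y : y \in M -> (x + y \in Q) = (x \in Q).
Proof.
suff H z w : w \in M -> z \in Q -> z + w \in Q.
  move=> yM; apply/idP/idP => [xyQ|]; last exact: H.
  by rewrite -[x](addrK y) H ?idealr_closedN.
move=> wM zQ; have Uz := unit_squares_unit zQ.
have -> : z + w = z * (1 + z^-1 * w) by rewrite mulrDr mulr1 mulVKr.
by rewrite unit_squaresM ?unit_squares1D ?idealr_closedMl.
Qed.

(** The coset [x * Q] misses [Q] and has half as many elements as the unit group, so it contains
    [y]; if [y = x * z], then [x * y = x ^+ 2 * z]. *)
Lemma unit_squares_nonsquaresM x y : x \is a GRing.unit -> y \is a GRing.unit ->
  x \notin Q -> y \notin Q -> x * y \in Q.
Proof.
move=> Ux Uy xQ yQ.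
have sQU : Q \subset U by apply/subsetP=> z /unit_squares_unit; rewrite inE.
have : [set x * z | z in Q] = U :\: Q.
  apply/eqP; rewrite eqEcard card_imset; last exact: mulrI.
  rewrite cardsD (setIidPr sQU) card_unit_squares mul2n -addnn addnK leqnn andbT.
  apply/subsetP=> _ /imsetP[z zQ ->].
  rewrite !inE unitrM Ux unit_squares_unit // !andbT.
  apply: contra xQ => xzQ; rewrite -[x](mulrK (unit_squares_unit zQ)).
  by rewrite unit_squaresM ?unit_squaresV.
move/setP/(_ y); rewrite !inE yQ Uy => /imsetP[z zQ ->].
rewrite mulrA unit_squaresM //; apply/unit_squaresP; by exists x.
Qed.

Lemma card_unit_squaresE : (2 * #|Q| = (q - 1) * #|M|)%N.
Proof. by rewrite -card_unit_squares card_unit_set. Qed.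

Lemma odd_card_unit_squares : odd #|Q| = (q == 3 %[mod 4]).
Proof.
have cardQ : #|Q| = (q./2 * #|M|)%N.
  apply/eqP; rewrite -(eqn_pmul2l (isT : 0 < 2)%N) card_unit_squaresE mulnA.
  by rewrite mul2n -[in (q - 1)%N](odd_double_half q) odd_q addKn.
rewrite cardQ oddM odd_card_maximal_ideal andbT.
by have := odd_q; lia.
Qed.

(** The parity of [#|Q|] is read off an involution: if -1 is a square, negation acts on [Q] without
    fixed points; otherwise inversion fixes only 1 in [Q]. *)
Lemma unit_squares_opp1 : (- 1 \in Q) = (q == 1 %[mod 4]).
Proof.
have -> : (q == 1 %[mod 4]) = ~~ odd #|Q|.
  rewrite odd_card_unit_squares; have := odd_q; lia.
apply/idP/idP=> [Q1 | ].
  rewrite (@odd_card_involution _ -%R); first last.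
  - by move=> x xQ; rewrite -mulN1r unit_squaresM.
  - exact: opprK.
  suff -> : [set x in Q | - x == x] = set0 by rewrite cards0.
  apply/setP=> x; rewrite !inE; apply/andP=> -[/unit_squares_unit/neg_neq].
  by move/negPf->.
apply: contraR => Q1; rewrite (@odd_card_involution _ GRing.inv); first last.
- exact: unit_squaresV.
- exact: invrK.
suff -> : [set x in Q | x^-1 == x] = [set 1] by rewrite cards1.
apply/setP=> x; rewrite !inE; apply/andP/eqP=> [[xQ /eqP xx] | ->].
  have Ux := unit_squares_unit xQ.
  have : x ^+ 2 == 1 ^+ 2 by rewrite expr1n expr2 -{1}xx mulVr.
  by rewrite unit_sqr_eq // => /orP[/eqP // | /eqP xN]; rewrite -xN xQ in Q1.
rewrite invr1 eqxx; split=> //; apply/unit_squaresP.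
by exists 1; rewrite ?unitr1 ?expr1n.
Qed.

End OddLocalRing.

(** * The quadratic character *)

Lemma sum_indicator (R : nzSemiRingType) (T : finType) (A : {set T}) :
  \sum_x (x \in A)%:R = #|A|%:R :> R.
Proof.
rewrite -sum1_card [in RHS]big_mkcond natr_sum.
by apply: eq_bigr => x _; case: (x \in A).
Qed.

Section QuadraticCharacter.
Variables (F : numFieldType) (S : finComUnitRingType) (M : {set S}).
Hypotheses (localM : local_ring M) (odd_q : odd (residue_card M)).
Local Notation Q := (unit_squares S).
Local Notation q := (residue_card M).
Local Notation m := (#|M|).
Implicit Types x y z : S.

Let idM : idealr_closed M. Proof. by case: localM => [[]]. Qed.
Let unitE x : (x \is a GRing.unit) = (x \notin M).
Proof. exact: local_ring_unit. Qed.

(** The quadratic character of the residue field, lifted to [S]: the second branch gives -1 on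
    nonsquare units and 0 on [M]. *)
Definition quad_char x : F := if x \in Q then 1 else - (x \notin M)%:R.
Local Notation chi := quad_char.

Lemma quad_char_ideal x : x \in M -> chi x = 0.
Proof.
rewrite /chi => xM; rewrite xM oppr0.
by case: ifP => // /unit_squares_unit; rewrite unitE xM.
Qed.

Lemma quad_charM x y : chi (x * y) = chi x * chi y.
Proof.
have [xM|] := boolP (x \in M).
  by rewrite mulrC !(quad_char_ideal xM) mul0r quad_char_ideal ?idealr_closedMl.
have [yM|] := boolP (y \in M).
  by rewrite (quad_char_ideal yM) mulr0 quad_char_ideal ?idealr_closedMl.
move=> yM xM; have xyM : x * y \notin M by rewrite -unitE unitrM !unitE xM.
rewrite /chi xM yM xyM.
have [xQ|xQ] := boolP (x \in Q); have [yQ|yQ] := boolP (y \in Q).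
- by rewrite unit_squaresM ?mulr1.
- rewrite mul1r ifN //; apply: contra yQ => xyQ.
  by rewrite -(mulKr (unit_squares_unit xQ) y) unit_squaresM ?unit_squaresV.
- rewrite mulr1 ifN //; apply: contra xQ => xyQ.
  by rewrite -(mulrK (unit_squares_unit yQ) x) unit_squaresM ?unit_squaresV.
- by rewrite (unit_squares_nonsquaresM localM) ?unitE // mulrNN mulr1.
Qed.

Lemma quad_charDr x y : y \in M -> chi (x + y) = chi x.
Proof.
by move=> yM; rewrite /chi (unit_squaresDr localM) // (idealr_closedDr _ idM).
Qed.

Lemma quad_char_sqr x : chi x ^+ 2 = (x \notin M)%:R.
Proof.
rewrite /chi; case: ifP => [/unit_squares_unit|_].
  by rewrite unitE expr1n => ->.
by rewrite sqrrN; case: (x \notin M); rewrite ?expr1n ?expr0n.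
Qed.

Lemma sum_quad_char : \sum_x chi x = 0.
Proof.
have chiE x : chi x = 2 * (x \in Q)%:R - (x \in unit_set S)%:R.
  rewrite /chi inE -unitE; case: ifP => [/unit_squares_unit -> | _].
    by rewrite mulr1 addrK.
  by rewrite mulr0 add0r.
rewrite (eq_bigr _ (fun x _ => chiE x)) sumrB -mulr_sumr !sum_indicator.
by rewrite (card_unit_squares localM) // natrM subrr.
Qed.

Lemma sum_sub (G : S -> F) z : \sum_y G (z - y) = \sum_y G y.
Proof.
rewrite [RHS](reindex_inj (inj_comp (addrI z) oppr_inj)).
by apply: eq_bigr.
Qed.

(* For a unit z, the substitution [y = z / u] turns the summand into
   [chi (u - 1)], a sum over the units. *)
Lemma conv_quad_char z :
  conv chi chi z = chi (- 1) * m%:R * (q%:R * (z \in M)%:R - 1).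
Proof.
rewrite /conv; have [zM|] := boolP (z \in M).
  (* For [z] in [M], [chi (z - y) = chi (- 1) * chi y], and [chi y ^+ 2] is the indicator of the
     units. *)
  rewrite (eq_bigr (fun y => chi (- 1) * (y \in unit_set S)%:R)) => [|y _].
    rewrite -mulr_sumr sum_indicator.
    by rewrite (card_unit_set localM) // natrM natrB ?odd_gt0 //= !mulr1n; ring.
  rewrite addrC quad_charDr // -[- y]mulN1r quad_charM -mulrA -expr2 quad_char_sqr.
  by rewrite inE unitE.
rewrite -unitE mulr0 sub0r => Uz.
rewrite (bigID (fun y => y \is a GRing.unit)) /= addrC big1 ?add0r => [|y]; last first.
  by rewrite unitE negbK => yM; rewrite (quad_char_ideal yM) mulr0.
rewrite (reindex_onto (fun u => z * u^-1) (fun u => z * u^-1)); last first.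
  by move=> y Uy; rewrite invrM ?unitrV // invrK mulrA mulrAC mulrV ?mul1r.
rewrite (eq_bigl (fun u => u \notin M)) => [|u]; last first.
  rewrite unitrMr // unitrV -unitE andb_idr // => Uu.
  by rewrite invrM ?unitrV // invrK mulrA mulrAC mulrV ?mul1r.
rewrite (eq_bigr (fun u => chi (- 1) * chi (1 - u))) => [|u]; last first.
  rewrite -unitE => Uu; have -> : z - z * u^-1 = z * u^-1 * (- 1 * (1 - u)).
    by rewrite mulN1r opprB mulrBr mulr1 mulrVK.
  rewrite quad_charM mulrAC -expr2 quad_char_sqr -unitE unitrMr // unitrV Uu.
  by rewrite mul1r quad_charM.
(* The values [chi (1 - u)] sum to 0 over all [u], and each [u] in [M] contributes 1; hence the
   units contribute [- m]. *)
have := sum_sub chi 1; rewrite sum_quad_char (bigID (fun u => u \in M)) /=.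
rewrite (eq_bigr (fun => 1)) => [|u uM]; last first.
  rewrite quad_charDr ?idealr_closedN // /chi.
  suff -> : 1 \in Q by [].
  by apply/unit_squaresP; exists 1; rewrite ?unitr1 ?expr1n.
rewrite sumr_const -mulr_sumr => /eqP; rewrite addrC addr_eq0 => /eqP->.
by rewrite mulrN1 mulrN.
Qed.

(** The multiplication table of the algebra spanned by 1, the indicator of [M] and [chi]. It reduces
    the idempotent relations to field identities. *)
Lemma conv_local (a b c a' b' c' : F) z :
  conv (fun x => a + b * (x \in M)%:R + c * chi x)
       (fun x => a' + b' * (x \in M)%:R + c' * chi x) z =
  (a * a' * (q * m)%:R + (a * b' + b * a' - c * c' * chi (- 1)) * m%:R)
  + (b * b' + c * c' * chi (- 1) * q%:R) * m%:R * (z \in M)%:R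
  + (b * c' + c * b') * m%:R * chi z.
Proof.
have idd := idM.
have sumM : \sum_y ((z - y \in M)%:R : F) = m%:R.
  by rewrite (sum_sub (fun y => (y \in M)%:R)) sum_indicator.
have sumC : \sum_y chi (z - y) = 0 by rewrite sum_sub sum_quad_char.
have inMB y : y \in M -> (z - y \in M) = (z \in M).
  by move=> yM; rewrite idealr_closedDr ?idealr_closedN.
have sumMM : \sum_y (z - y \in M)%:R * (y \in M)%:R = m%:R * (z \in M)%:R :> F.
  rewrite mulrC -sum_indicator mulr_sumr; apply: eq_bigr => y _.
  by case: (boolP (y \in M)) => [/inMB -> //|_]; rewrite !mulr0.
have sumCM : \sum_y chi (z - y) * (y \in M)%:R = m%:R * chi z.
  rewrite mulrC -sum_indicator mulr_sumr; apply: eq_bigr => y _.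
  case: (boolP (y \in M)) => [yM|_]; rewrite ?mulr0 //.
  by rewrite quad_charDr // idealr_closedN.
have sumMC : \sum_y (z - y \in M)%:R * chi y = m%:R * chi z.
  rewrite -sumCM -(sum_sub (fun y => chi (z - y) * (y \in M)%:R) z).
  by apply: eq_bigr => y _; rewrite subKr mulrC.
have sumCC := conv_quad_char z; rewrite /conv in sumCC.
rewrite /conv (eq_bigr (fun y => a * a' + a * b' * (y \in M)%:R + a * c' * chi y
  + (b * a' * (z - y \in M)%:R + b * b' * ((z - y \in M)%:R * (y \in M)%:R)
     + b * c' * ((z - y \in M)%:R * chi y))
  + (c * a' * chi (z - y) + c * b' * (chi (z - y) * (y \in M)%:R)
     + c * c' * (chi (z - y) * chi y)))) => [|y _]; last by ring.
rewrite !big_split /= -!mulr_sumr sumM sumC sumMM sumCM sumMC sumCC.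
rewrite sum_indicator sum_quad_char sumr_const (card_local_ring localM).
by rewrite -mulr_natr; ring.
Qed.

End QuadraticCharacter.

(** * Idempotents of the local factors *)

Lemma big_option_bool (R : Type) (idx : R) (op : Monoid.com_law idx)
    (G : option bool -> R) :
  \big[op/idx]_b G b = op (G None) (op (G (Some false)) (G (Some true))).
Proof.
rewrite (bigD1 None) //= (reindex_omap Some id) => [|[b|]] //=.
rewrite (eq_bigl xpredT) => [|b]; last by rewrite eqxx.
by rewrite big_bool; congr (op _ _); rewrite Monoid.mulmC.
Qed.

Section LocalSpectrum.
Variables (F : rcfType) (S : finComUnitRingType) (M : {set S}).
Hypotheses (localM : local_ring M) (odd_q : odd (residue_card M)).
Local Notation Q := (unit_squares S).
Local Notation U := (unit_set S).
Local Notation q := (residue_card M).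
Local Notation m := (#|M|).
Local Notation chi := (quad_char F M).

Let m0 : m%:R != 0 :> F.
Proof.
by rewrite pnatr_eq0 -lt0n; apply/card_gt0P; exists 0; case: localM => [[[]]].
Qed.
Let q0 : q%:R != 0 :> F. Proof. by rewrite pnatr_eq0 -lt0n odd_gt0. Qed.
Let cardS : #|S|%:R = q%:R * m%:R :> F.
Proof. by rewrite (card_local_ring localM) natrM. Qed.
Let cardU : #|U|%:R = (q%:R - 1) * m%:R :> F.
Proof. by rewrite (card_unit_set localM) // natrM natrB ?odd_gt0. Qed.
Let M0 : 0 \in M. Proof. by case: localM => [[[]]]. Qed.

(* The vanishing terms put the idempotents in the form of [conv_local]. *)
Definition unitary_idem (b : bool) (x : S) : F :=
  (-1) ^+ b * #|S|%:R^-1 + (if b then m%:R^-1 else 0) * (x \in M)%:R + 0 * chi x.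

(** The value at [true] is [- m], taken on the functions of sum 0 that are constant on the cosets of
    [M]; the value at [false] is the degree. *)
Definition unitary_val (b : bool) : F :=
  if b then - (#|U|%:R / (q%:R - 1)) else #|U|%:R.

Lemma conv_unitary_idem i j :
  conv (unitary_idem i) (unitary_idem j) =1 if i == j then unitary_idem i else fun=> 0.
Proof.
move=> z; rewrite conv_local // -(card_local_ring localM) cardS.
by case: i j => [] [] /=; rewrite /unitary_idem /= ?cardS; field; rewrite q0 m0.
Qed.

(** This is the trace of the convolution operator, hence a multiplicity. *)
Lemma unitary_idem0 b : #|S|%:R * unitary_idem b 0 = (if b then q - 1 else 1)%N%:R.
Proof.
rewrite /unitary_idem M0 cardS /=.
by case: b => /=; rewrite ?natrB ?odd_gt0 // !mulr1n; field; rewrite q0 m0.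
Qed.

Lemma unit_set_idem x : (1 < q)%N ->
  (x \in U)%:R = \sum_b unitary_val b * unitary_idem b x.
Proof.
move=> q1; rewrite big_bool /unitary_val /unitary_idem /= inE (local_ring_unit _ localM).
rewrite cardU cardS; have q10 : q%:R - 1 != 0 :> F by rewrite subr_eq0 (eqr_nat F q 1); lia.
by case: (x \in M) => /=; rewrite ?mulr1n ?mulr0n; field; rewrite q0 m0 q10.
Qed.

Hypothesis q1 : q = 1 %[mod 4].
Local Notation s := (Num.sqrt q%:R : F).

Let s2 : s ^+ 2 = q%:R. Proof. by rewrite sqr_sqrtr ?ler0n. Qed.
Let s0 : s != 0. Proof. by apply: contraNneq q0 => s0; rewrite -s2 s0 expr0n. Qed.
Let chi1 : chi (- 1) = 1.
Proof. by rewrite /quad_char (unit_squares_opp1 localM) ?q1 ?eqxx. Qed.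

(* [Some false] and [Some true] stand for the membership of an index in A and in
   B, respectively, and [None] for neither. *)
Definition paley_idem (b : option bool) (x : S) : F :=
  match b with
  | None => #|S|%:R^-1 + 0 * (x \in M)%:R + 0 * chi x
  | Some eps => - (2 * #|S|%:R)^-1 + (2 * m%:R)^-1 * (x \in M)%:R
                + (-1) ^+ eps * (2 * m%:R * s)^-1 * chi x
  end.

(** As [q - 1 = (s - 1) * (s + 1)], the values at [Some] are [m * (s - 1) / 2] and
    [- m * (s + 1) / 2], that is, [m] times the nontrivial Paley eigenvalues. *)
Definition paley_val (b : option bool) : F :=
  if b is Some eps then (-1) ^+ eps * (#|U|%:R / (2 * (s + (-1) ^+ eps)))
  else #|U|%:R / 2.

Lemma conv_paley_idem i j :
  conv (paley_idem i) (paley_idem j) =1 if i == j then paley_idem i else fun=> 0.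
Proof.
move=> z; case: i j => [[]|] [[]|] /=;
  rewrite conv_local // -(card_local_ring localM) /paley_idem cardS chi1;
  (* The root becomes a variable [t] and [q] becomes [t ^+ 2], leaving a rational identity. *)
  move: s0 s2; move: (Num.sqrt _) => t t0 <-; rewrite ?expr0 ?expr1;
  by field; rewrite t0 m0.
Qed.

Lemma paley_idem0 b :
  #|S|%:R * paley_idem b 0 = (if b is Some _ then (q - 1) %/ 2 else 1)%N%:R.
Proof.
have -> : #|S|%:R * paley_idem b 0 = if b is Some _ then (q%:R - 1) / 2 else 1.
  case: b => [eps|]; rewrite /paley_idem M0 quad_char_ideal // cardS /= !mulr1n;
  by field; rewrite ?s0 q0 m0.
case: b => [_|] //; rewrite -[in LHS](@natrB _ q 1) ?odd_gt0 //.
have -> : (q - 1 = (q - 1) %/ 2 * 2)%N by have := odd_q; lia.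
by rewrite mulnK // natrM mulfK // pnatr_eq0.
Qed.

Lemma unit_squares_idem x : (1 < q)%N ->
  (x \in Q)%:R = \sum_b paley_val b * paley_idem b x.
Proof.
move=> q_gt1; have s1 : 1 < s.
  by rewrite -[X in X < _](sqrtr1 F) ltr_sqrt ?ltr1n // ltr0n odd_gt0.
have s10 : s + 1 != 0 by rewrite lt0r_neq0 //; lra.
have s_10 : s - 1 != 0 by rewrite lt0r_neq0 //; lra.
rewrite big_option_bool /paley_val /paley_idem /= cardU cardS expr0 expr1.
move: s0 s2 s10 s_10; move: (Num.sqrt _) => t t0 <- t1 t_1.
have -> : (x \in Q)%:R = (1 - (x \in M)%:R + chi x) / 2.
  rewrite /quad_char; case: ifP => [/unit_squares_unit|_].
    by rewrite (local_ring_unit _ localM) => /negPf ->; rewrite /= mulr0n mulr1n; field.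
  by case: (x \in M); rewrite /= ?mulr0n ?mulr1n; field.
by field; rewrite t0 m0 t1 t_1.
Qed.

End LocalSpectrum.

(** * Products *)

(** Passing through [fprod] makes the dependent functions families of tagged values, to which
    [bigA_distr_big_dep] applies. *)
Lemma sum_prod_dffun (K : comNzSemiRingType) (I : finType) (T : I -> finType)
    (G : forall i, T i -> K) :
  \sum_(x : {dffun forall i, T i}) \prod_i G i (x i) = \prod_i \sum_y G i y.
Proof.
pose P i : {ffun T i -> K} := [ffun y => G i y].
transitivity (\sum_(t : fprod T) \prod_(i in I) P i (t i)).
  rewrite (reindex (@fprod_of_dffun _ T)); last exact/onW_bij/fprod_of_dffun_bij.
  by apply: eq_bigr => x _; apply: eq_bigr => i _; rewrite ffunE fprodE.
rewrite big_fprod; transitivity (\prod_i \sum_(y : T i) P i y); last first.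
  by apply: eq_bigr => i _; apply: eq_bigr => y _; rewrite ffunE.
under [RHS]eq_bigr => i _ do rewrite (big_tag (fun i y => P i y) i).
by rewrite bigA_distr_big_dep.

Qed.

Lemma natr_forall (K : comNzSemiRingType) (I : finType) (P : pred I) :
  [forall i, P i]%:R = \prod_i (P i)%:R :> K.
Proof.
case: forallP => [allP | /forallP]; first by rewrite big1 // => i _; rewrite allP.
by rewrite negb_forall => /existsP[i /negPf Pi]; rewrite (bigD1 i) //= Pi mul0r.
Qed.

Lemma residue_card_gt1 (S : finComUnitRingType) (M : {set S}) :
  local_ring M -> (1 < residue_card M)%N.
Proof.
move=> localM; have [[[M0 M1 _] _] _] := localM.
have : (#|M| < #|S|)%N.
  rewrite -cardsT; apply/proper_card; rewrite properT.
  by apply: contraNneq M1 => ->; rewrite inE.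
by rewrite (card_local_ring localM) -{1}[#|M|]mul1n ltn_mul2r => /andP[].
Qed.

(** * Disjoint pairs of subsets as three-valued functions *)

Section Decode.
Variable I : finType.
Implicit Types AB : {set I} * {set I}.

Definition code AB (i : I) : option bool :=
  if i \in AB.1 then Some false else if i \in AB.2 then Some true else None.

Definition decode (g : {ffun I -> option bool}) : {set I} * {set I} :=
  ([set i | g i == Some false], [set i | g i == Some true]).

(** [code] tests the first set first, so an index in both sets is lost from the second. *)
Lemma codeK AB : (decode (finfun (code AB)) == AB) = (AB \in disjoint_pairs I).
Proof.
case: AB => A B; rewrite inE /=; apply/eqP/idP => [[_ BE] | dAB].
  rewrite disjoint_subset; apply/subsetP=> i iA; rewrite inE.
  by move/setP/(_ i): BE; rewrite inE ffunE /code /= iA => <-.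
congr pair; apply/setP=> i; rewrite inE ffunE /code /=; case: ifP => //.
  by case: ifP.
by move=> iA; rewrite (disjointFr dAB iA).
by case: ifP.
Qed.

Lemma decodeK g : finfun (code (decode g)) = g.
Proof.
by apply/ffunP=> i; rewrite ffunE /code !inE; case: (g i) => [[]|].
Qed.

Lemma code_inj :
  {in disjoint_pairs I &, forall AB AB', code AB =1 code AB' -> AB = AB'}.
Proof.
move=> AB AB' dAB dAB' eq_code.
rewrite -codeK in dAB; rewrite -codeK in dAB'.
rewrite -(eqP dAB) -(eqP dAB').
by congr decode; apply/ffunP=> i; rewrite !ffunE.
Qed.

Lemma prod_code (K : comNzSemiRingType) AB (a b : I -> K) :
  AB \in disjoint_pairs I ->
  \prod_i (if code AB i is Some eps then if eps then b i else a i else 1) =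
  \prod_(i in AB.1) a i * \prod_(i in AB.2) b i.
Proof.
rewrite inE => dAB; rewrite [X in X * _]big_mkcond [X in _ * X]big_mkcond.
rewrite -big_split; apply: eq_bigr => i _; rewrite /code.
case: ifP => [iA | _] /=; first by rewrite (disjointFr dAB iA) mulr1.
by case: ifP; rewrite mul1r.
Qed.

(** Expanding the product selects one of three terms at each index, and such selections correspond
    to disjoint pairs. *)
Lemma prod_sum_code (K : comNzSemiRingType) (G : I -> option bool -> K) :
  \prod_i \sum_b G i b =
  \sum_(AB in disjoint_pairs I) \prod_i G i (code AB i).
Proof.
rewrite bigA_distr_bigA (reindex_onto (fun AB => finfun (code AB)) decode) /=.
  apply: eq_big => [AB | AB _]; first by rewrite codeK.
  by apply: eq_bigr => i _; rewrite ffunE.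
by move=> g _; rewrite decodeK.
Qed.

End Decode.

(** * Convolution, units and connection set of a product ring *)

Section Product.
Variables (F : numFieldType) (n : nat) (R : 'I_n.+1 -> finComUnitRingType).
Variables (R0 : finComUnitRingType).
Local Notation P := (prod_ring R).

Lemma conv_tensor (f0 g0 : R0 -> F) (f g : forall i, R i -> F) (z : R0 * P) :
  conv (fun z : R0 * P => f0 z.1 * \prod_i f i (z.2 i))
       (fun z : R0 * P => g0 z.1 * \prod_i g i (z.2 i)) z =
  conv f0 g0 z.1 * \prod_i conv (f i) (g i) (z.2 i).
Proof.
rewrite /conv -(sum_prod_dffun (fun i y => f i (z.2 i - y) * g i y)) big_distrlr.
rewrite pair_big_dep /=; apply: eq_bigr => y _.
rewrite big_split /= mulrACA; congr (_ * _ * _).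
by congr (_ * _); apply: eq_bigr => i _; rewrite !ffunE.
Qed.

Lemma card_unit_set_prod : #|unit_set P| = (\prod_i #|unit_set (R i)|)%N.
Proof.
rewrite -[LHS]natn -[LHS]sum_indicator.
transitivity (\sum_(x : {dffun forall i, R i})
    \prod_i ((x i \in unit_set (R i))%:R : nat)).
  apply: eq_bigr => x _; rewrite -natr_forall inE.
  congr (nat_of_bool _)%:R; apply: eq_forallb => i; by rewrite inE.
rewrite (sum_prod_dffun (fun i y => (y \in unit_set (R i))%:R : nat)).
by apply: eq_bigr => i _; rewrite sum_indicator natn.
Qed.

(** One of [z.1] and [- z.1] is a square in [R0]; applying the same sign to the other components
    keeps them squares, since -1 is a square there. *)
Lemma qu_connection_prod (M : forall i, {set R i}) (M0 : {set R0}) (z : R0 * P) :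
  (forall i, local_ring (M i)) -> (forall i, residue_card (M i) = 1 %[mod 4]) ->
  local_ring M0 -> residue_card M0 = 3 %[mod 4] ->
  (z \in qu_connection (R0 * P)%type) =
  (z.1 \in unit_set R0) && [forall i, z.2 i \in unit_squares (R i)].
Proof.
move=> localM modM localM0 modM0.
have oddM i : odd (residue_card (M i)) by have := modM i; lia.
have oddM0 : odd (residue_card M0) by lia.
have QN i x : (- x \in unit_squares (R i)) = (x \in unit_squares (R i)).
  suff QN y : y \in unit_squares (R i) -> - y \in unit_squares (R i).
    by apply/idP/idP=> /QN; rewrite ?opprK.
  by rewrite -mulN1r => /(unit_squaresM _) ->; rewrite ?(unit_squares_opp1 (localM i))
    ?modM.
apply/idP/andP=> [|[Uz Qz]].
  have sq (w : R0 * P) : w \in unit_squares (R0 * P)%type ->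
      (w.1 \is a GRing.unit) && [forall i, w.2 i \in unit_squares (R i)].
    case/unit_squaresP=> -[u0 u] /andP[/= Uu0 /forallP Uu] ->.
    rewrite expr2 /= unitrM Uu0; apply/forallP=> i; rewrite ffunE -expr2.
    by apply/unit_squaresP; exists (u i); first exact: Uu.
  rewrite inE => /orP[/sq /andP[]|]; first by rewrite inE.
  rewrite inE => /imsetP[w /sq /andP[Uw /forallP Qw] ->].
  rewrite /=; split; first by rewrite unitrN.
  by apply/forallP=> i; rewrite ffunE QN; apply: Qw.
have [eps Qeps] : exists b : bool, (-1) ^+ b * z.1 \in unit_squares R0.
  rewrite inE in Uz; have [Q0 | Q0] := boolP (z.1 \in unit_squares R0).
    by exists false; rewrite expr0 mul1r.
  exists true; rewrite expr1 (unit_squares_nonsquaresM localM0) ?unitrN1 //.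
  by rewrite (unit_squares_opp1 localM0) // modM0.
have {}Qz i : (-1) ^+ eps * z.2 i \in unit_squares (R i).
  by have/forallP/(_ i) := Qz; case: eps {Qeps}; rewrite ?mulN1r ?QN ?mul1r.
case/unit_squaresP: Qeps => u0 Uu0 u0E.
(* Componentwise square roots; [Qz] ensures that the default 0 is never taken. *)
pose u : P := [ffun i => odflt 0
    [pick v | (v \is a GRing.unit) && ((-1) ^+ eps * z.2 i == v ^+ 2)]].
have uP i : (u i \is a GRing.unit) /\ (-1) ^+ eps * z.2 i = u i ^+ 2.
  rewrite ffunE; case: pickP => [v /andP[Uv /eqP] // | no].
  by have/unit_squaresP[v Uv /eqP vE] := Qz i; have := no v; rewrite Uv vE.
clearbody u.
have sqE : (-1) ^+ eps * z = (u0, u) ^+ 2.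
  apply: injective_projections; last apply/ffunP=> i; rewrite !expr2.
    by case: (eps) u0E; rewrite ?mul1r ?mulN1r.
  have [_] := uP i; rewrite expr2; case: (eps); rewrite ?mul1r ?mulN1r !ffunE;
  by move=> ->.
have Qw : (-1) ^+ eps * z \in unit_squares (R0 * P)%type.
  rewrite sqE; apply/unit_squaresP; exists (u0, u) => //.
  by apply/andP; split=> //; apply/forallP=> i; case: (uP i).
rewrite inE; case: eps Qw {u0E uP Qz u sqE} => /= Qw;
  last by rewrite mul1r in Qw; rewrite Qw.
apply/orP; right; apply/imsetP; exists (- z); last by rewrite opprK.
by rewrite mulN1r in Qw.
Qed.

End Product.

(** * Eigenvalues and multiplicities of the product *)

Section Multiplicities.
Variables (F : rcfType) (n : nat) (R : 'I_n.+1 -> finComUnitRingType).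
Variables (M : forall i, {set R i}).
Hypotheses (localM : forall i, local_ring (M i)).
Hypotheses (oddM : forall i, odd (residue_card (M i))).
Implicit Types AB : {set 'I_n.+1} * {set 'I_n.+1}.

(** Each factor is half the number of units times a correction on A or B; the negative corrections
    on B produce the sign. *)
Lemma lambda_code AB : AB \in disjoint_pairs 'I_n.+1 ->
  lambda F M AB.1 AB.2 = \prod_i paley_val F (M i) (code AB i).
Proof.
move=> dAB; rewrite /lambda card_unit_set_prod natr_prod.
pose s i : F := Num.sqrt (residue_card (M i))%:R.
rewrite [RHS](eq_bigr (fun i => #|unit_set (R i)|%:R / 2 *
    (if code AB i is Some eps then if eps then - (s i - 1)^-1 else (s i + 1)^-1
     else 1))) => [|i _]; last first.
  rewrite /paley_val -/(s i); case: (code AB i) => [[]|]; rewrite ?mulr1 //=.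
    by rewrite expr1 mulN1r invfM mulrN mulrA.
  by rewrite expr0 mul1r invfM mulrA.
rewrite big_split /= prod_code // big_split /= prodr_const card_ord.
rewrite prodrN !prodfV exprVn !invfM -/s.
by ring.
Qed.

(** Every [residue_card (M k) - 1] is even, and disjointness makes the number of factors equal to
    the exponent of 2. *)
Lemma repetitionsE c AB : AB \in disjoint_pairs 'I_n.+1 ->
  repetitions M c AB.1 AB.2 =
  (c * \prod_(k in AB.1 :|: AB.2) ((residue_card (M k) - 1) %/ 2))%N.
Proof.
rewrite inE => dAB; rewrite /repetitions.
rewrite (eq_bigr (fun k => (residue_card (M k) - 1) %/ 2 * 2)%N) => [|k _].
  rewrite big_split /= prod_nat_const cardsU (disjoint_setI0 dAB) cards0 subn0.
  by rewrite mulnA mulnK // expn_gt0.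
by have := oddM k; lia.
Qed.

Lemma repetitions_code AB : AB \in disjoint_pairs 'I_n.+1 ->
  \prod_i (if code AB i is Some _ then (residue_card (M i) - 1) %/ 2 else 1)%N =
  (\prod_(k in AB.1 :|: AB.2) ((residue_card (M k) - 1) %/ 2))%N.
Proof.
rewrite [RHS]big_mkcond => _; apply: eq_bigr => i _.
by rewrite inE /code; case: ifP => //=; case: ifP.
Qed.

End Multiplicities.

(* The rings R_1, ..., R_s are R 0, ..., R n, with s = n.+1 >= 1. In the
   multiplicity of 0 the subtraction cannot be truncated: the exponents of the
   factorization of the characteristic polynomial add up to |R0 x R|. *)
Theorem theorem2p7 (F : rcfType) (n : nat)
    (R : 'I_n.+1 -> finComUnitRingType) (M : forall i : 'I_n.+1, {set R i})
    (R0 : finComUnitRingType) (M0 : {set R0})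
    (localR : forall i : 'I_n.+1, local_ring (M i))
    (sortedR : forall i j : 'I_n.+1, (i <= j)%N ->
       (residue_card (M i) <= residue_card (M j))%N)
    (modR : forall i : 'I_n.+1, residue_card (M i) = 1 %[mod 4])
    (localR0 : local_ring M0)
    (modR0 : residue_card M0 = 3 %[mod 4]) :
  @has_spectrum F (R0 * prod_ring R)%type
    (@qu_cayley (R0 * prod_ring R)%type)
    ([seq (#|unit_set R0|%:R * lambda F M AB.1 AB.2,
           repetitions M 1 AB.1 AB.2)
     | AB <- enum (disjoint_pairs 'I_n.+1)]
     ++ [seq (- (#|unit_set R0|%:R / ((residue_card M0)%:R - 1)
                 * lambda F M AB.1 AB.2),
              repetitions M (residue_card M0 - 1) AB.1 AB.2)
        | AB <- enum (disjoint_pairs 'I_n.+1)]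
     ++ [:: (0, (#|R0| * #|{: prod_ring R}|
                 - \sum_(AB in disjoint_pairs 'I_n.+1)
                     repetitions M (residue_card M0) AB.1 AB.2)%N)]).
Proof.
have oddR i : odd (residue_card (M i)) by have := modR i; lia.
have oddR0 : odd (residue_card M0) by lia.
set D := disjoint_pairs _; set P := prod_ring R.
pose J := (bool * ({set 'I_n.+1} * {set 'I_n.+1}))%type.
(* The boolean separates the families (a) and (b), through the two idempotents of [R0]. *)
pose r : seq J := [seq (b, AB) | b <- [:: false; true], AB <- enum D].
have mem_r (k : J) : k \in r -> k.2 \in D.
  by case/allpairsP=> -[b AB] /= [_ + ->]; rewrite mem_enum.
pose c (k : J) : F := unitary_val F M0 k.1 * lambda F M k.2.1 k.2.2.
pose mult0 (b : bool) := (if b then residue_card M0 - 1 else 1)%N.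
pose t (k : J) := repetitions M (mult0 k.1) k.2.1 k.2.2.
pose e (k : J) (z : R0 * P) : F := unitary_idem F M0 k.1 z.1 *
  \prod_i paley_idem F (M i) (code k.2 i) (z.2 i).
have big_r (K : Type) (idx : K) (op : Monoid.com_law idx) (G : J -> K) :
  \big[op/idx]_(k <- r) G k = \big[op/idx]_b \big[op/idx]_(AB in D) G (b, AB).
  rewrite big_bool /r /= cats0 big_cat !big_map !big_enum /=.
  by rewrite Monoid.mulmC.
(* For each pair the multiplicities of the two families combine through [1 + (q - 1) = q], with [q]
   the residue cardinal of [R0]. *)
have sum_t : (\sum_(k <- r) t k)%N =
    (\sum_(AB in D) repetitions M (residue_card M0) AB.1 AB.2)%N.
  rewrite big_r exchange_big /=; apply: eq_bigr => AB dAB.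
  rewrite big_bool /t /= !repetitionsE // -mulnDl; congr (_ * _)%N.
  by rewrite /mult0; lia.
rewrite -sum_t -card_prod catA.
rewrite [X in X ++ _](_ : _ = [seq (c k, t k) | k <- r]); last first.
  rewrite /r /= cats0 map_cat -!map_comp; congr (_ ++ _).
  by apply: eq_map => AB; rewrite /= /c /t /= mulNr.
apply: (@conv_spectrum F (R0 * P)%type _ _ r e c t).
- by rewrite allpairs_uniq ?enum_uniq // => -[? ?] [? ?].
- move=> [b AB] [b' AB'] /mem_r dAB /mem_r dAB' z; rewrite /e.
  rewrite (conv_tensor (unitary_idem F M0 b) (unitary_idem F M0 b')
    (fun i => paley_idem F (M i) (code AB i))
    (fun i => paley_idem F (M i) (code AB' i))).
  rewrite conv_unitary_idem //.
  under eq_bigr => i _ do rewrite conv_paley_idem //.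
  rewrite xpair_eqE; case: (b == b') => /=; last by rewrite mul0r.
  case: (AB =P AB') => [-> | neqAB].
    by congr (_ * _); apply: eq_bigr => i _; rewrite eqxx.
  (* Distinct disjoint pairs have codes that differ at some index, where the convolution factor
     vanishes. *)
  have [/forallP/= eq_code | ] := boolP [forall i, code AB i == code AB' i].
    by case: neqAB; apply: code_inj => // i; apply/eqP.
  rewrite negb_forall => /existsP[i /negPf neq_i].
  by rewrite (bigD1 i) //= neq_i mul0r mulr0.
- move=> [b AB] /mem_r dAB; rewrite /t repetitionsE // /= natrM -unitary_idem0 //.
  rewrite -repetitions_code // natr_prod /e /= card_prod natrM.
  have -> : #|{: P}|%:R = \prod_i #|R i|%:R :> F.
    by rewrite card_dep_ffun foldrE big_image natr_prod.
  rewrite mulrACA -big_split /=; congr (_ * _); apply: eq_bigr => i _.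
  by rewrite ffunE paley_idem0 //; case: (code AB i).
- move=> z; rewrite (qu_connection_prod _ localR modR localR0 modR0).
  rewrite -mulnb natrM natr_forall (unit_set_idem F localR0) ?residue_card_gt1 //.
  under [X in _ * X]eq_bigr => i _ do
    rewrite (unit_squares_idem F (localR i)) ?residue_card_gt1 //.
  (* Expanding the product of the local decompositions gives one tensor idempotent for each boolean
     and disjoint pair. *)
  rewrite prod_sum_code big_distrlr big_r /=; apply: eq_bigr => b _.
  apply: eq_bigr => AB dAB; rewrite /c /e lambda_code // big_split /=.
  by rewrite mulrACA.
Qed.
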